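(* Let $G$ be a graph on $[n]$ that is closed with respect to its given labelling of vertices. Then $\mathrm{in}_\tau(\mathcal{R}(J_G))=\mathcal{R}(\mathrm{in}_\sigma(J_G))$ and the relation type of $J_G$ is at most $2$. Moreover, the set $\{x_i,y_i:1\le i\le n\}\cup\{f_et:e\in E(G)\}$ is a Sagbi basis of $\mathcal{R}(J_G)$ with respect to $\tau$.
   Context: Graphs are finite and simple. $S=\mathbb{K}[x_1,\ldots,x_n,y_1,\ldots,y_n]$, and for $e=\{i,j\}\in E(G)$ with $i<j$, $f_e=x_iy_j-x_jy_i$; $J_G=(f_e:e\in E(G))$. $\sigma$ is the lexicographic order induced by $x_1>\cdots>x_n>y_1>\cdots>y_n$; $G$ is closed with respect to the given labelling if $\{f_e\}$ is a Gröbner basis of $J_G$ w.r.t. $\sigma$. The Rees algebra is $\mathcal{R}(I)=\bigoplus_{k\ge0}I^kt^k\subset S[t]$. The term order $\tau$ on $S[t]$: for monomials $u,v\in S$ and $i,j\ge0$, $ut^i<_\tau vt^j$ iff $i<j$, or $i=j$ and $u<_\sigma v$. For a $\mathbb{K}$-subalgebra $A$ of a polynomial ring, the initial algebra $\mathrm{in}_\tau(A)$ is the $\mathbb{K}$-algebra generated by $\{\mathrm{in}_\tau(f):f\in A\}$, and a subset $B\subset A$ is a Sagbi basis if $\{\mathrm{in}_\tau(b):b\in B\}$ generates $\mathrm{in}_\tau(A)$ as a $\mathbb{K}$-algebra. Writing $\mathcal{R}(I)\cong R/\ker\psi$ with $R=S[t_1,\ldots,t_m]$, $\psi(t_i)=f_it$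 for minimal generators $f_i$ of $I$, the relation type of $I$ is the largest $t$-degree of a minimal generator of $\ker\psi$. *)

(* Defs.v *)
From mathcomp Require Import all_boot all_order all_algebra.
From mathcomp Require Import mpoly.

Set Implicit Arguments.
Unset Strict Implicit.
Unset Printing Implicit Defensive.

Import GRing.Theory.
Local Open Scope ring_scope.

Definition set_eq (A : Type) (P Q : A -> Prop) : Prop := forall q, P q <-> Q q.

(* ideal_gen C P = { sum_k c_k g_k : c_k in C, g_k in P } (finite sums).
   With C the coefficient ring this is the ideal generated by P; with C an
   ideal I and P an ideal J it is the product ideal I J. *)
Definition ideal_gen (A : comNzRingType) (C P : A -> Prop) : A -> Prop :=
  fun q => exists s : seq (A * A),
    (forall cg, cg \in s -> C cg.1 /\ P cg.2) /\ q = \sum_(cg <- s) cg.1 * cg.2.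

Definition alg_gen (K : fieldType) (k : nat) (P : {mpoly K[k]} -> Prop)
  : {mpoly K[k]} -> Prop :=
  fun q => exists s : seq (K * seq {mpoly K[k]}),
    (forall cs, cs \in s -> forall g, g \in cs.2 -> P g) /\
    q = \sum_(cs <- s) cs.1 *: \prod_(g <- cs.2) g.

Definition lex_lt (k : nat) (m1 m2 : 'X_{1..k}) : bool :=
  [exists i : 'I_k, (m1 i < m2 i)%N &&
     [forall j : 'I_k, (j < i)%N ==> (m1 j == m2 j)]].

Definition lead_mono (K : fieldType) (k : nat) (lt : rel 'X_{1..k})
  (p : {mpoly K[k]}) : 'X_{1..k} :=
  foldr (fun m acc => if lt acc m then m else acc) 0%MM (msupp p).

Definition init (K : fieldType) (k : nat) (lt : rel 'X_{1..k})
  (p : {mpoly K[k]}) : {mpoly K[k]} :=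
  if p == 0 then 0 else 'X_[lead_mono lt p].

(* The ring S[t] = K[x_1..x_n, y_1..y_n, t], as {mpoly K[(2n).+1]}:        *)
(*   x_i = variable i-1, y_i = variable n+i-1, t = variable 2n.           *)
(* S is the subring of t-free polynomials.                                *)

Section Binomial.
Variables (K : fieldType) (n : nat).

Local Notation T := {mpoly K[(2 * n).+1]}.

Definition tvar : 'I_((2 * n).+1) := ord_max.
Definition xvar (i : 'I_n) : 'I_((2 * n).+1) := inord i.
Definition yvar (i : 'I_n) : 'I_((2 * n).+1) := inord (n + i).

Definition xx (i : 'I_n) : T := 'X_(xvar i).
Definition yy (i : 'I_n) : T := 'X_(yvar i).
Definition tt : T := 'X_tvar.

Definition inS (p : T) : Prop := forall m, m \in msupp p -> m tvar = 0%N.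

(* sigma: lex with x_1 > ... > x_n > y_1 > ... > y_n (> t); on t-free
   monomials this is exactly the order sigma of the paper. *)
Definition sigma_lt : rel 'X_{1..(2 * n).+1} := fun m1 m2 => lex_lt m1 m2.

Definition tau_lt : rel 'X_{1..(2 * n).+1} := fun m1 m2 =>
  (m1 tvar < m2 tvar)%N || ((m1 tvar == m2 tvar) && lex_lt m1 m2).

Definition SIdeal (P : T -> Prop) : T -> Prop := ideal_gen inS P.

Fixpoint idpow (I : T -> Prop) (k : nat) : T -> Prop :=
  match k with
  | 0 => inS
  | k'.+1 => ideal_gen (idpow I k') I
  end.

Definition Rees (I : T -> Prop) : T -> Prop :=
  fun p => exists s : seq (nat * T),
    (forall kq, kq \in s -> idpow I kq.1 kq.2) /\
    p = \sum_(kq <- s) kq.2 * tt ^+ kq.1.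

Definition initial_ideal (lt : rel 'X_{1..(2 * n).+1}) (I : T -> Prop)
  : T -> Prop := SIdeal (fun g => exists f, I f /\ g = init lt f).

Definition initial_algebra (lt : rel 'X_{1..(2 * n).+1}) (A : T -> Prop)
  : T -> Prop := alg_gen (fun g => exists f, A f /\ g = init lt f).

Definition sagbi (lt : rel 'X_{1..(2 * n).+1}) (A B : T -> Prop) : Prop :=
  (forall b, B b -> A b) /\
  set_eq (alg_gen (fun g => exists b, B b /\ g = init lt b))
         (initial_algebra lt A).

(* Graphs on [n] = 'I_n: a symmetric irreflexive relation G.
   Edge {i,j} with i < j is recorded as the pair (i, j). *)
Definition edges (G : rel 'I_n) : {set 'I_n * 'I_n} :=
  [set e : 'I_n * 'I_n | (e.1 < e.2)%N && G e.1 e.2].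

Definition fe (i j : 'I_n) : T := xx i * yy j - xx j * yy i.

Definition BEgens (G : rel 'I_n) : T -> Prop :=
  fun f => exists e, e \in edges G /\ f = fe e.1 e.2.

Definition JG (G : rel 'I_n) : T -> Prop := SIdeal (BEgens G).

(* G closed w.r.t. the given labelling: {f_e} is a Groebner basis of J_G
   w.r.t. sigma, i.e. in_sigma(J_G) = (in_sigma(f_e) : e in E(G)). *)
Definition closed_graph (G : rel 'I_n) : Prop :=
  set_eq (initial_ideal sigma_lt (JG G))
         (SIdeal (fun g => exists f, BEgens G f /\ g = init sigma_lt f)).

(* Presentation R = S[t_e : e in E(G)] = {mpoly K[2n + |E(G)|]}, with
   psi(x_i) = x_i, psi(y_i) = y_i, psi(t_e) = f_e t. *)
Definition psi_var (G : rel 'I_n) (i : 'I_(2 * n + #|edges G|)) : T :=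
  match split i with
  | inl a => 'X_(widen_ord (leqnSn (2 * n)) a)
  | inr e => let p := enum_val e in fe p.1 p.2 * tt
  end.

Definition psi (G : rel 'I_n) (g : {mpoly K[2 * n + #|edges G|]}) : T :=
  g \mPo [tuple @psi_var G i | i < 2 * n + #|edges G|].

Definition ker_psi (G : rel 'I_n) : {mpoly K[2 * n + #|edges G|]} -> Prop :=
  fun g => @psi G g = 0.

Definition tdeg (G : rel 'I_n) (m : 'X_{1..2 * n + #|edges G|}) : nat :=
  \sum_(i < 2 * n + #|edges G| | (2 * n <= i)%N) m i.

Definition thomog (G : rel 'I_n) (d : nat) (g : {mpoly K[2 * n + #|edges G|]})
  : Prop := forall m, m \in msupp g -> @tdeg G m = d.

Definition reltype_le (G : rel 'I_n) (d : nat) : Prop :=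
  forall g, @ker_psi G g ->
    ideal_gen (fun _ => True)
      (fun h => @ker_psi G h /\ exists e, (e <= d)%N /\ @thomog G e h) g.

Definition sagbiB (G : rel 'I_n) : T -> Prop :=
  fun b => (exists i, b = xx i \/ b = yy i) \/
           (exists e, e \in edges G /\ b = fe e.1 e.2 * tt).

End Binomial.

(* Main.v *)
Require Import Defs.
From mathcomp Require Import all_boot all_order all_algebra.
From mathcomp Require Import mpoly.
From mathcomp Require Import ring zify.

(** Let [phi] send a monomial of [S[t_e]] to the leading monomial of its image
    under [psi], so [t_e |-> x_i y_j t] for [e = (i, j)].  Modulo the relations
    of t-degree at most 2 in the kernel of [psi], and modulo monomials with
    smaller [phi], two monomials with the same [phi] are congruent.  Indeed, take
    the edge [(i, j)] with [j], then [i], maximal among all [t_e] occurring in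
    either monomial; one exchange (linear, Koszul or Plücker) makes [t_(i,j)]
    appear in the other monomial, and it can be divided out.  Closedness is what
    puts the edges needed for the tails of these exchanges into [G].

    Hence every polynomial is congruent, modulo the low-degree relations, to a
    combination of one representative monomial per fibre of [phi].  The images of
    representatives have distinct leading monomials, so such a combination is in
    the kernel only if it is zero (relation type), and otherwise its image has a
    leading monomial in the image of [phi] (Sagbi basis). *)

Set Implicit Arguments.
Unset Strict Implicit.
Unset Printing Implicit Defensive.

Import GRing.Theory.
Local Open Scope ring_scope.

(** * Ideals, subalgebras and Rees algebras by generators *)

Section IdealGen.
Variables (A : comNzRingType) (C P : A -> Prop).

Lemma ideal_gen0 : ideal_gen C P 0.
Proof. by exists [::]; rewrite big_nil. Qed.

Lemma ideal_genD p q : ideal_gen C P p -> ideal_gen C P q -> ideal_gen C P (p + q).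
Proof.
move=> [s [hs ->]] [u [hu ->]]; exists (s ++ u); rewrite big_cat; split=> // cg.
by rewrite mem_cat => /orP[/hs|/hu].
Qed.

Lemma mem_ideal_gen c g : C c -> P g -> ideal_gen C P (c * g).
Proof.
move=> hc hg; exists [:: (c, g)]; rewrite big_seq1; split=> // cg.
by rewrite inE => /eqP->.
Qed.

Lemma ideal_gen_ind (Q : A -> Prop) :
  Q 0 -> (forall p q, Q p -> Q q -> Q (p + q)) ->
  (forall c g, C c -> P g -> Q (c * g)) -> forall p, ideal_gen C P p -> Q p.
Proof.
move=> q0 qD qM p [s [hs ->]]; rewrite big_seq.
by apply: big_ind => // cg /hs[]; apply: qM.
Qed.

Lemma ideal_genMl a p :
  (forall c, C c -> C (a * c)) -> ideal_gen C P p -> ideal_gen C P (a * p).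
Proof.
move=> ha; elim/ideal_gen_ind => [|x y hx hy|c g hc hg].
- by rewrite mulr0; exact: ideal_gen0.
- by rewrite mulrDr; exact: ideal_genD.
- by rewrite mulrA; apply: mem_ideal_gen => //; exact: ha.
Qed.

End IdealGen.

Lemma ideal_gen_sub (A : comNzRingType) (C C' P P' : A -> Prop) p :
  (forall q, C q -> C' q) -> (forall q, P q -> P' q) ->
  ideal_gen C P p -> ideal_gen C' P' p.
Proof.
move=> hC hP [s [hs ->]]; exists s; split=> // cg /hs[].
by split; [exact: hC | exact: hP].
Qed.

Section AlgGen.
Variables (K : fieldType) (k : nat).
Implicit Types P Q : {mpoly K[k]} -> Prop.

Lemma alg_gen_ind P Q :
  Q 1 -> (forall p q, Q p -> Q q -> Q (p + q)) ->
  (forall c p, Q p -> Q (c *: p)) ->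
  (forall g p, P g -> Q p -> Q (g * p)) -> forall p, alg_gen P p -> Q p.
Proof.
move=> q1 qD qZ qM p [s [hs ->]]; rewrite big_seq; apply: big_ind => //.
  by rewrite -[0](scale0r 1); exact: qZ.
case=> c l /hs /= hl; apply: qZ; rewrite big_seq.
elim/big_rec: _ => // g x gl; apply: qM; exact: hl.
Qed.

Lemma alg_gen0 P : alg_gen P 0.
Proof. by exists [::]; rewrite big_nil. Qed.

Lemma alg_gen1 P : alg_gen P 1.
Proof.
exists [:: (1, [::])]; rewrite big_seq1 /= big_nil scale1r; split=> // cs.
by rewrite inE => /eqP->.
Qed.

Lemma alg_genD P p q : alg_gen P p -> alg_gen P q -> alg_gen P (p + q).
Proof.
move=> [s [hs ->]] [u [hu ->]]; exists (s ++ u); rewrite big_cat; split=> // cs.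
by rewrite mem_cat => /orP[/hs|/hu].
Qed.

Lemma alg_genZ P c p : alg_gen P p -> alg_gen P (c *: p).
Proof.
move=> [s [hs ->]]; exists [seq (c * cs.1, cs.2) | cs <- s]; split.
  by move=> _ /mapP[cs /hs hcs ->].
by rewrite big_map scaler_sumr; apply: eq_bigr => cs _; rewrite scalerA.
Qed.

Lemma alg_gen_mul_gen P g p : P g -> alg_gen P p -> alg_gen P (g * p).
Proof.
move=> hg [s [hs ->]]; exists [seq (cs.1, g :: cs.2) | cs <- s]; split.
  by move=> _ /mapP[cs /hs hcs ->] h /=; rewrite inE => /predU1P[->//|/hcs].
rewrite big_map mulr_sumr; apply: eq_bigr => cs _.
by rewrite /= big_cons scalerAr.
Qed.

Lemma mem_alg_gen P g : P g -> alg_gen P g.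
Proof. by move=> hg; rewrite -[g]mulr1; apply: alg_gen_mul_gen => //; exact: alg_gen1. Qed.

Lemma alg_genM P p q : alg_gen P p -> alg_gen P q -> alg_gen P (p * q).
Proof.
move=> hp hq; elim/alg_gen_ind: p / hp => [|x y hx hy|c x hx|g x hg hx].
- by rewrite mul1r.
- by rewrite mulrDl; exact: alg_genD.
- by rewrite -scalerAl; exact: alg_genZ.
- by rewrite -mulrA; exact: alg_gen_mul_gen.
Qed.

Lemma alg_gen_sum P (I : Type) (r : seq I) (R : pred I) (F : I -> {mpoly K[k]}) :
  (forall i, R i -> alg_gen P (F i)) -> alg_gen P (\sum_(i <- r | R i) F i).
Proof. by move=> h; apply: big_ind => //; [exact: alg_gen0 | exact: alg_genD]. Qed.

Lemma alg_gen_prod P (I : Type) (r : seq I) (R : pred I) (F : I -> {mpoly K[k]}) :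
  (forall i, R i -> alg_gen P (F i)) -> alg_gen P (\prod_(i <- r | R i) F i).
Proof. by move=> h; apply: big_ind => //; [exact: alg_gen1 | exact: alg_genM]. Qed.

Lemma alg_genX P p e : alg_gen P p -> alg_gen P (p ^+ e).
Proof.
by move=> hp; elim: e => [|e ih]; rewrite ?exprS; [exact: alg_gen1 | exact: alg_genM].
Qed.

Lemma alg_gen_sub P Q p :
  (forall g, P g -> alg_gen Q g) -> alg_gen P p -> alg_gen Q p.
Proof.
move=> h; elim/alg_gen_ind => [|x y|c x|g x hg].
- exact: alg_gen1.
- exact: alg_genD.
- exact: alg_genZ.
- by apply: alg_genM; exact: h.
Qed.

End AlgGen.

Section ReesGen.
Variables (K : fieldType) (n : nat).
Local Notation T := {mpoly K[(2 * n).+1]}.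
Implicit Types (p q : T) (I P : T -> Prop).

Lemma inS1 : inS (1 : T).
Proof. by move=> m; rewrite msupp1 inE => /eqP->; rewrite mnm0E. Qed.

Lemma inSD p q : inS p -> inS q -> inS (p + q).
Proof. by move=> hp hq m /msuppD_le; rewrite mem_cat => /orP[/hp|/hq]. Qed.

Lemma inSZ c p : inS p -> inS (c *: p).
Proof. by move=> hp m /msuppZ_le /hp. Qed.

Lemma inSM p q : inS p -> inS q -> inS (p * q).
Proof.
move=> hp hq m /msuppM_le /allpairsP[[a b] /= [/hp ha /hq hb ->]].
by rewrite mnmDE ha hb.
Qed.

Lemma inSX (m : 'X_{1..(2 * n).+1}) : m (tvar n) = 0%N -> inS ('X_[m] : T).
Proof. by move=> h x; rewrite msuppX inE => /eqP->. Qed.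

Lemma xvarE (i : 'I_n) : xvar i = i :> nat.
Proof. by rewrite inordK //; have := ltn_ord i; lia. Qed.

Lemma yvarE (i : 'I_n) : yvar i = (n + i)%N :> nat.
Proof. by rewrite inordK //; have := ltn_ord i; lia. Qed.

Lemma xvar_tvar (i : 'I_n) : (xvar i == tvar n) = false.
Proof. by apply/eqP => /(congr1 val) /=; rewrite xvarE; have := ltn_ord i; lia. Qed.

Lemma yvar_tvar (i : 'I_n) : (yvar i == tvar n) = false.
Proof. by apply/eqP => /(congr1 val) /=; rewrite yvarE; have := ltn_ord i; lia. Qed.

Lemma xvar_yvar (i j : 'I_n) : (xvar i == yvar j) = false.
Proof. by apply/eqP => /(congr1 val) /=; rewrite yvarE xvarE; have := ltn_ord i; lia. Qed.

Lemma xvar_inj (i j : 'I_n) : (xvar i == xvar j) = (i == j).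
Proof. by rewrite -(inj_eq val_inj) /= !xvarE. Qed.

Lemma yvar_inj (i j : 'I_n) : (yvar i == yvar j) = (i == j).
Proof. by rewrite -(inj_eq val_inj) /= !yvarE eqn_add2l. Qed.

Variant var_spec : 'I_(2 * n).+1 -> Prop :=
  | VarX i : var_spec (xvar i)
  | VarY i : var_spec (yvar i)
  | VarT : var_spec (tvar n).

Lemma varP v : var_spec v.
Proof.
case: (ltnP v n) => [vn|nv].
  suff -> : v = xvar (Ordinal vn) by constructor.
  by apply: val_inj; rewrite /= xvarE.
case: (ltnP v (2 * n)) => [v2|v2].
  have vn : (v - n < n)%N by lia.
  suff -> : v = yvar (Ordinal vn) by constructor.
  by apply: val_inj; rewrite /= yvarE /=; lia.
suff -> : v = tvar n by constructor.
by apply: val_inj => /=; have := ltn_ord v; lia.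
Qed.

Lemma inS_xx (i : 'I_n) : inS (xx K i).
Proof. by apply: inSX; rewrite mnm1E xvar_tvar. Qed.

Lemma inS_yy (i : 'I_n) : inS (yy K i).
Proof. by apply: inSX; rewrite mnm1E yvar_tvar. Qed.

Definition rees_gen P : T -> Prop :=
  fun g => (exists i, g = xx K i \/ g = yy K i) \/ exists p, P p /\ g = p * tt K n.

Lemma idpow_inSM I e s p : inS s -> idpow I e p -> idpow I e (s * p).
Proof.
elim: e p => [|e ih] p hs /=; first exact: inSM.
by apply: ideal_genMl => c; exact: ih.
Qed.

Lemma idpow_sub I J e p :
  (forall q, I q -> J q) -> idpow I e p -> idpow J e p.
Proof. by move=> h; elim: e p => //= e ih p; exact: ideal_gen_sub. Qed.

Lemma Rees_sub I J p : (forall q, I q -> J q) -> Rees I p -> Rees J p.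
Proof.
move=> h [s [hs ->]]; exists s; split=> // kq /hs; exact: idpow_sub.
Qed.

Lemma inS_alg_gen P p :
  (forall i, P (xx K i)) -> (forall i, P (yy K i)) -> inS p -> alg_gen P p.
Proof.
move=> hx hy hp; rewrite (mpolyE p) big_seq; apply: alg_gen_sum => m /hp hm.
apply: alg_genZ; rewrite mpolyXE_id; apply: alg_gen_prod => v _.
case: (varP v) => [i|i|]; last by rewrite hm expr0; exact: alg_gen1.
  by apply/alg_genX/mem_alg_gen; exact: hx.
by apply/alg_genX/mem_alg_gen; exact: hy.
Qed.

(** This reduces statements about Rees algebras to algebra generators; it serves both [J_G] and its
    initial ideal. Forwards, an element of the [e]-th power is peeled into one factor per power of
    [t]. Backwards, a Rees algebra contains 1 and is stable under sums, scalars and multiplication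
    by each generator. *)
Lemma Rees_SIdeal P : set_eq (Rees (SIdeal P)) (alg_gen (rees_gen P)).
Proof.
have xP i : rees_gen P (xx K i) by left; exists i; left.
have yP i : rees_gen P (yy K i) by left; exists i; right.
move=> p; split.
  case=> s [hs ->]; rewrite big_seq; apply: alg_gen_sum => -[e q] /hs /= {s hs}.
  elim: e q => [|e ih] q /=; first by rewrite expr0 mulr1; exact: inS_alg_gen.
  elim/ideal_gen_ind => [|x y hx hy|c g hc].
  - by rewrite mul0r; exact: alg_gen0.
  - by rewrite mulrDl; exact: alg_genD.
  rewrite exprSr mulrACA => hg; apply: alg_genM; first exact: ih.
  elim/ideal_gen_ind: g / hg => [|x y hx hy|d g hd hg].
  - by rewrite mul0r; exact: alg_gen0.
  - by rewrite mulrDl; exact: alg_genD.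
  rewrite -mulrA; apply: alg_genM; first exact: inS_alg_gen.
  by apply: mem_alg_gen; right; exists g.
elim/alg_gen_ind => {p} [|p q [s [hs ->]] [u [hu ->]]|c p [s [hs ->]]|g p hg [s [hs ->]]].
- exists [:: (0%N, 1)]; rewrite big_seq1 mulr1; split=> // kq.
  by rewrite inE => /eqP->; exact: inS1.
- exists (s ++ u); rewrite big_cat; split=> // kq.
  by rewrite mem_cat => /orP[/hs|/hu].
- exists [seq (kq.1, c%:MP * kq.2) | kq <- s]; split.
    move=> _ /mapP[kq /hs hq ->] /=; apply: idpow_inSM hq.
    by rewrite -[_%:MP]mulr1 mul_mpolyC; apply: inSZ; exact: inS1.
  by rewrite big_map scaler_sumr; apply: eq_bigr => kq _; rewrite /= mul_mpolyC scalerAl.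
case: hg => [[i hi]|[f [hf ->]]].
  exists [seq (kq.1, g * kq.2) | kq <- s]; split.
    move=> _ /mapP[kq /hs hq ->] /=; apply: idpow_inSM hq.
    by case: hi => ->; [exact: inS_xx | exact: inS_yy].
  by rewrite big_map mulr_sumr; apply: eq_bigr => kq _; rewrite /= mulrA.
exists [seq (kq.1.+1, kq.2 * f) | kq <- s]; split.
  move=> _ /mapP[kq /hs hq ->] /=; apply: mem_ideal_gen => //.
  by rewrite -[f]mul1r; apply: mem_ideal_gen => //; exact: inS1.
by rewrite big_map mulr_sumr; apply: eq_bigr => kq _; rewrite /= exprS; ring.
Qed.

End ReesGen.

(** * Monomial orders and leading monomials *)

Record monomial_order (k : nat) (lt : rel 'X_{1..k}) : Prop := MonomialOrder {
  mo_irr : irreflexive lt;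
  mo_trans : transitive lt;
  mo_total : forall a b, a != b -> lt a b || lt b a;
  mo_add : forall m a b, lt (a + m)%MM (b + m)%MM = lt a b;
  mo_pos : forall m, m != 0%MM -> lt 0%MM m }.

Section LexOrder.
Variable k : nat.
Implicit Types (m a b : 'X_{1..k}).

Lemma lex_ltP a b :
  reflect (exists2 i : 'I_k, (a i < b i)%N & forall j : 'I_k, (j < i)%N -> a j = b j)
          (lex_lt a b).
Proof.
apply: (iffP existsP) => -[i].
  by case/andP=> h /forallP hj; exists i => // j ji; have /implyP/(_ ji)/eqP := hj j.
move=> h hj; exists i; rewrite h; apply/forallP => j.
by apply/implyP => /hj ->.
Qed.

Lemma first_diff a b : a != b ->
  exists2 i : 'I_k, a i != b i & forall j : 'I_k, (j < i)%N -> b j = a j.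
Proof.
move=> neq; have [i0 hi0] : exists i, a i != b i.
  apply/existsP; apply: contraNT neq => /existsPn h; apply/eqP/mnmP => i.
  by apply/eqP; have := h i; rewrite negbK.
case: (arg_minnP (P := fun i => a i != b i) val hi0) => i hi imin; exists i => // j ji.
by apply/esym/eqP; apply: contraLR ji => /imin; rewrite -leqNgt.
Qed.

Lemma lex_lt_monomial_order : monomial_order (@lex_lt k).
Proof.
split=> [a|b a c|a b neq|m a b|m m0].
- by apply/lex_ltP => -[i]; rewrite ltnn.
- move=> /lex_ltP[i hi ei] /lex_ltP[j hj ej]; apply/lex_ltP.
  case: (ltngtP i j) => [ij|ji|/val_inj ij].
  + exists i => [|l li]; first by rewrite -ej.
    by rewrite (ei l li) (ej l (ltn_trans li ij)).
  + exists j => [|l lj]; first by rewrite ei.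
    by rewrite (ei l (ltn_trans lj ji)) (ej l lj).
  + exists i => [|l li]; first by rewrite (ltn_trans hi) // ij.
    by rewrite (ei l li) ej // -ij.
- have [i hi ej] := first_diff neq.
  by move: hi; rewrite neq_ltn => /orP[h|h]; apply/orP; [left|right];
    apply/lex_ltP; exists i => // j /ej.
- apply/lex_ltP/lex_ltP => -[i hi hj]; exists i.
  + by move: hi; rewrite !mnmDE ltn_add2r.
  + by move=> j /hj; rewrite !mnmDE => /addIn.
  + by rewrite !mnmDE ltn_add2r.
  + by move=> j /hj; rewrite !mnmDE => ->.
- have [i hi ej] := first_diff m0; apply/lex_ltP; exists i => [|j /ej//].
  by move: hi; rewrite mnm0E lt0n.
Qed.

End LexOrder.

(** Functions on [nat] keep the type fixed while [k] varies, and let the t-exponent be placed in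
    front of the other exponents. *)
Definition lexn (k : nat) (f g : nat -> nat) : Prop :=
  exists i, [/\ (i < k)%N, (f i < g i)%N & forall j, (j < i)%N -> f j = g j].

(** Nested induction: outer on the first [k] values, well-founded by the hypothesis on [k], and
    inner on a bound [N] for the value at position [k] while the earlier values stay fixed. *)
Lemma lexn_wf k : well_founded (lexn k).
Proof.
elim: k => [|k ih]; first by move=> f; constructor=> g [i []].
suff H f : forall N g, (forall j, (j < k)%N -> g j = f j) -> (g k < N)%N -> Acc (lexn k.+1) g.
  by move=> f; apply: (H f (f k).+1).
elim/(well_founded_ind ih): f => f IH.
elim=> [g _|N IHN g gf gk]; first by rewrite ltn0.
constructor=> h [i [ik hg e]].
have [ik'|ki] := ltnP i k.
  apply: (IH h _ (h k).+1) => //; exists i; split=> //; first by rewrite -gf.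
  by move=> j ji; rewrite e // gf // (ltn_trans ji).
have ei : i = k by apply/eqP; rewrite eqn_leq -ltnS ik.
rewrite {}ei {i ik ki} in hg e *.
apply: IHN => [j jk|]; first by rewrite e // gf.
exact: leq_trans hg gk.
Qed.

Section Below.
Variables (K : fieldType) (k : nat) (lt : rel 'X_{1..k}).
Hypothesis ltM : monomial_order lt.
Implicit Types (p q : {mpoly K[k]}) (a b m : 'X_{1..k}).

Definition below m p := forall m', m' \in msupp p -> lt m' m.

Lemma below0 m : below m 0.
Proof. by move=> m'; rewrite msupp0. Qed.

Lemma belowD m p q : below m p -> below m q -> below m (p + q).
Proof. by move=> hp hq m' /msuppD_le; rewrite mem_cat => /orP[/hp|/hq]. Qed.

Lemma belowZ m c p : below m p -> below m (c *: p).
Proof. by move=> hp m' /msuppZ_le /hp. Qed.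

Lemma below_sum m (I : Type) (r : seq I) (R : pred I) (F : I -> {mpoly K[k]}) :
  (forall i, R i -> below m (F i)) -> below m (\sum_(i <- r | R i) F i).
Proof. by move=> h; apply: big_ind => //; [exact: below0 | exact: belowD]. Qed.

Lemma belowX m a : lt a m -> below m 'X_[a].
Proof. by move=> h m'; rewrite msuppX inE => /eqP->. Qed.

Lemma below_trans m m' p : lt m m' -> below m p -> below m' p.
Proof. by move=> h hp a /hp ha; exact: (mo_trans ltM ha h). Qed.

Lemma mo_addl m a b : lt (m + a)%MM (m + b)%MM = lt a b.
Proof. by rewrite ![(m + _)%MM]addmC (mo_add ltM). Qed.

Lemma belowMX a b p : below a p -> below (a + b) (p * 'X_[b]).
Proof.
move=> hp m; rewrite (perm_mem (msuppMX _ _)) => /mapP[m' /hp h ->].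
by rewrite addmC (mo_add ltM).
Qed.

Lemma belowM a b p q : below a p -> below b q -> below (a + b) (p * q).
Proof.
move=> hp hq m /msuppM_le /allpairsP[[u v] /= [/hp ha /hq hb ->]].
by apply: (mo_trans ltM (y := (a + v)%MM)); rewrite ?(mo_add ltM) ?mo_addl.
Qed.

(** Leading coefficient 1 and leading monomial [m], phrased as a bound on the remainder, so that
    products are handled by expansion without computing leading terms. *)
Definition monic_lead p m := below m (p - 'X_[m]).

Lemma monic_leadX m : monic_lead 'X_[m] m.
Proof. by rewrite /monic_lead subrr; exact: below0. Qed.

Lemma monic_leadM p q a b :
  monic_lead p a -> monic_lead q b -> monic_lead (p * q) (a + b).
Proof.
move=> hp hq; rewrite /monic_lead.
have -> : p * q - 'X_[a + b] = (p - 'X_[a]) * (q - 'X_[b]) + (p - 'X_[a]) * 'X_[b]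
    + (q - 'X_[b]) * 'X_[a] by rewrite mpolyXD; ring.
apply: belowD; first by apply: belowD; [exact: belowM | exact: belowMX].
by rewrite addmC; exact: belowMX.
Qed.

(** The fold starts from the exponent 0. This default is harmless because 0 is the least exponent,
    so it loses to any other maximum of the list. *)
Lemma foldr_max (s : seq 'X_{1..k}) m :
  m \in s -> (forall a, a \in s -> a != m -> lt a m) ->
  foldr (fun a acc => if lt acc a then a else acc) 0%MM s = m.
Proof.
have nlt a : (a != m -> lt a m) -> lt m a = false.
  move=> h; apply/negP => ma; have [am|/h am] := eqVneq a m.
    by rewrite am (mo_irr ltM) in ma.
  by have := mo_trans ltM ma am; rewrite (mo_irr ltM).
have foldr_in (s' : seq 'X_{1..k}) :
    foldr (fun a acc => if lt acc a then a else acc) 0%MM s' \in 0%MM :: s'.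
  elim: s' => [|a s' ih] /=; first exact: mem_head.
  case: ifP => _; first by rewrite !inE eqxx orbT.
  by move: ih; rewrite !inE => /orP[->//|->]; rewrite !orbT.
elim: s => //= a s ih; rewrite inE => hm hs.
have hs' b : b \in s -> b != m -> lt b m by move=> bs; apply: hs; rewrite inE bs orbT.
have [ms|ms] := boolP (m \in s).
  by rewrite ih // nlt //; apply: hs; exact: mem_head.
move: hm; rewrite (negbTE ms) orbF => /eqP ma; rewrite -{}ma {a hs}.
set r := foldr _ _ _.
have [->|rm] := eqVneq r m; first by rewrite if_same.
suff -> : lt r m by [].
have := foldr_in s; rewrite -/r inE => /predU1P[r0|rs]; last exact: hs'.
by rewrite r0; apply: (mo_pos ltM); rewrite eq_sym -r0.
Qed.

Lemma init_below p m c :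
  c != 0 -> below m (p - c *: 'X_[m]) -> p != 0 /\ init lt p = 'X_[m].
Proof.
move=> c0 hp.
have pm : p@_m = c.
  rewrite -[p](subrK (c *: 'X_[m])) mcoeffD mcoeffZ mcoeffX eqxx mulr1.
  rewrite (memN_msupp_eq0 (p := _ - _)) ?add0r //.
  by apply/negP => /hp; rewrite (mo_irr ltM).
have mp : m \in msupp p by rewrite mcoeff_msupp pm.
have p0 : p != 0 by apply: contraTneq mp => ->; rewrite msupp0.
split=> //; rewrite /init (negbTE p0) /lead_mono (foldr_max mp) // => a ap am.
apply: hp; rewrite mcoeff_msupp mcoeffB mcoeffZ mcoeffX [m == a]eq_sym (negbTE am) mulr0 subr0.
by rewrite -mcoeff_msupp.
Qed.

Lemma init_monic p m : monic_lead p m -> init lt p = 'X_[m].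
Proof.
by move=> h; apply: (proj2 (@init_below p m 1 _ _)); rewrite ?oner_eq0 ?scale1r.
Qed.

End Below.

Section Tau.
Variable n : nat.
Implicit Types (a b m : 'X_{1..(2 * n).+1}).

Lemma tau_lt_monomial_order : monomial_order (@tau_lt n).
Proof.
have [irr trans total add pos] := lex_lt_monomial_order (2 * n).+1.
split=> [a|b a c|a b neq|m a b|m m0]; rewrite /tau_lt.
- by rewrite ltnn eqxx irr.
- case: (ltngtP (a _) (b _)) => [ab|//|->] /=.
    by move=> _ /orP[/(ltn_trans ab)->//|/andP[/eqP<- _]]; rewrite ab.
  by case: ltngtP => //= _; exact: trans.
- by case: ltngtP => //= _; exact: total.
- by rewrite !mnmDE ltn_add2r eqn_add2r add.
- by rewrite mnm0E; case: (m _) => //=; exact: pos.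
Qed.

Lemma tau_lt_wf : well_founded (fun a b => tau_lt a b).
Proof.
(* [F] lists the t-exponent first and then all [2n+1] exponents in order, the last of which is t
   again; hence the length [2n+2]. *)
pose F m i := if i is i'.+1 then m (inord i') else m (tvar n).
have sub a b : tau_lt a b -> lexn (2 * n).+2 (F a) (F b).
  move=> /orP[h|/andP[/eqP e /lex_ltP[i h hj]]]; first by exists 0%N; split.
  exists i.+1; split=> /=; rewrite ?inord_val //; first by rewrite ltnS.
  move=> [|j] //= ji; apply: hj; rewrite inordK //.
  by have := ltn_ord i; lia.
move=> a; move: {2}(F a) (erefl (F a)) => f.
elim/(well_founded_ind (@lexn_wf (2 * n).+2)): f a => f IH a ea.
by constructor=> b /sub; rewrite ea => /IH; apply.
Qed.

End Tau.

(** * Closed graphs *)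

Section Closed.
Variables (K : fieldType) (n : nat) (G : rel 'I_n).
Local Notation T := {mpoly K[(2 * n).+1]}.
Implicit Types i j k l : 'I_n.

(** These are the two monomials of [fe i j]; the first variable in which they differ is [x_i]. *)
Lemma lex_lt_exchange i j : (i < j)%N ->
  lex_lt (U_(xvar j) + U_(yvar i))%MM (U_(xvar i) + U_(yvar j))%MM.
Proof.
move=> ij; apply/lex_ltP; exists (xvar i) => [|v].
  by rewrite !mnmDE !mnm1E !xvar_inj ![yvar _ == _]eq_sym !xvar_yvar eqxx -val_eqE gtn_eqF.
rewrite xvarE => vi; rewrite !mnmDE !mnm1E -!val_eqE /= !xvarE !yvarE.
by have := ltn_ord i; lia.
Qed.

Lemma tau_lt_exchange i j : (i < j)%N ->
  tau_lt (U_(xvar j) + U_(yvar i))%MM (U_(xvar i) + U_(yvar j))%MM.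
Proof.
move=> ij; rewrite /tau_lt lex_lt_exchange // andbT.
by rewrite !mnmDE !mnm1E !xvar_tvar !yvar_tvar eqxx orbT.
Qed.

Lemma monic_lead_fe (lt : rel 'X_{1..(2 * n).+1}) i j :
  lt (U_(xvar j) + U_(yvar i))%MM (U_(xvar i) + U_(yvar j))%MM ->
  monic_lead lt (fe K i j) (U_(xvar i) + U_(yvar j)).
Proof.
move=> h; rewrite /monic_lead mpolyXD /fe addrAC subrr add0r -scaleN1r -mpolyXD.
by apply: belowZ; exact: belowX.
Qed.

Lemma init_fe i j : (i < j)%N ->
  init (@sigma_lt n) (fe K i j) = 'X_[U_(xvar i) + U_(yvar j)].
Proof.
move=> ij; apply: (init_monic (lex_lt_monomial_order _)).
by apply: monic_lead_fe; exact: lex_lt_exchange.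
Qed.

Lemma mem_edges i j : ((i, j) \in edges G) = (i < j)%N && G i j.
Proof. by rewrite inE. Qed.

Hypothesis Hclosed : @closed_graph K n G.

(** Closedness enters here: [m] lies in the monomial ideal generated by the [x_i y_j] over the
    edges, so one of these divides it. *)
Lemma JG_init_edge (f : T) m : JG G f -> monic_lead (@sigma_lt n) f m ->
  exists i j, [/\ (i, j) \in edges G, (0 < m (xvar i))%N & (0 < m (yvar j))%N].
Proof.
move=> hf lf.
have : initial_ideal (@sigma_lt n) (JG G) ('X_[m] : T).
  rewrite -['X_[m]]mul1r; apply: mem_ideal_gen; first exact: inS1.
  by exists f; split=> //; rewrite (init_monic (lex_lt_monomial_order _) lf).
move/Hclosed => h.
(* Divisibility is claimed for every monomial of the support, a form that survives sums in the
   induction over ideal elements. *)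
suff : forall m', m' \in msupp ('X_[m] : T) -> exists i j,
  [/\ (i, j) \in edges G, (0 < m' (xvar i))%N & (0 < m' (yvar j))%N].
  by apply; rewrite msuppX mem_head.
elim/ideal_gen_ind: _ / h => [m'|p q hp hq m'|c g _ [_ [[[i j] [ij ->]] ->]] m'].
- by rewrite msupp0.
- by move/msuppD_le; rewrite mem_cat => /orP[/hp|/hq].

rewrite init_fe; last by move: ij; rewrite mem_edges => /andP[].
rewrite (perm_mem (msuppMX _ _)) => /mapP[v _ ->]; exists i, j; split=> //.
  by rewrite !mnmDE !mnm1E eqxx; lia.
by rewrite !mnmDE !mnm1E eqxx; lia.
Qed.

Lemma JG_fe i j : (i, j) \in edges G -> JG G (fe K i j).
Proof.
move=> ij; rewrite -[fe _ _ _]mul1r; apply: mem_ideal_gen; first exact: inS1.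
by exists (i, j).
Qed.

(* [x_k f_ij - x_i f_kj = x_j f_ik], with leading monomial [x_i x_j y_k]. *)
Lemma closed_edge_lower i k j :
  (i < k)%N -> (i, j) \in edges G -> (k, j) \in edges G -> (i, k) \in edges G.
Proof.
move=> ik ij kj; have kltj : (k < j)%N by move: kj; rewrite mem_edges => /andP[].
have hf : JG G (fe K i k * xx K j).
  have -> : fe K i k * xx K j = xx K k * fe K i j + (-1 *: xx K i) * fe K k j.
    by rewrite scaleN1r /fe; ring.
  apply: ideal_genD; apply: ideal_genMl; try exact: JG_fe.
    by move=> c; apply: inSM; exact: inS_xx.
  by move=> c; apply: inSM; apply: inSZ; exact: inS_xx.
have /(JG_init_edge hf) [p [q [pq]]] :
    monic_lead (@sigma_lt n) (fe K i k * xx K j) (U_(xvar i) + U_(yvar k) + U_(xvar j)).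
  apply: (monic_leadM (lex_lt_monomial_order _)); last exact: monic_leadX.
  by apply: monic_lead_fe; exact: lex_lt_exchange.
rewrite !mnmDE !mnm1E !xvar_inj !yvar_inj ![yvar _ == xvar _]eq_sym !xvar_yvar.
have pltq : (p < q)%N by move: pq; rewrite mem_edges => /andP[].
(* An edge [(p, q)] with [x_p y_q] dividing [x_i x_j y_k] has [q = k] and [p] equal to [i] or [j];
   since [k < j], the choice [p = j] would violate [p < q]. *)
move=> hp hq; have kq : k = q by apply/eqP; move: hq; case: (k == q).
have [->|ip] := eqVneq i p; first by rewrite kq.
have jp : j = p by apply/eqP; move: hp; rewrite (negbTE ip); case: (j == p).
by rewrite -jp -kq in pltq; lia.
Qed.

(** From [y_j f_il - y_l f_ij = y_i f_jl], with leading monomial [x_j y_l y_i]: an edge dividing it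
    starts at [j], and it ends at [l] because [i < j] excludes [y_i]. *)
Lemma closed_edge_upper i j l :
  (j < l)%N -> (i, j) \in edges G -> (i, l) \in edges G -> (j, l) \in edges G.
Proof.
move=> jl ij il; have iltj : (i < j)%N by move: ij; rewrite mem_edges => /andP[].
have hf : JG G (fe K j l * yy K i).
  have -> : fe K j l * yy K i = yy K j * fe K i l + (-1 *: yy K l) * fe K i j.
    by rewrite scaleN1r /fe; ring.
  apply: ideal_genD; apply: ideal_genMl; try exact: JG_fe.
    by move=> c; apply: inSM; exact: inS_yy.
  by move=> c; apply: inSM; apply: inSZ; exact: inS_yy.
have /(JG_init_edge hf) [p [q [pq]]] :
    monic_lead (@sigma_lt n) (fe K j l * yy K i) (U_(xvar j) + U_(yvar l) + U_(yvar i)).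
  apply: (monic_leadM (lex_lt_monomial_order _)); last exact: monic_leadX.
  by apply: monic_lead_fe; exact: lex_lt_exchange.
rewrite !mnmDE !mnm1E !xvar_inj !yvar_inj ![yvar _ == xvar _]eq_sym !xvar_yvar.
have pltq : (p < q)%N by move: pq; rewrite mem_edges => /andP[].
move=> hp hq; have jp : j = p by apply/eqP; move: hp; case: (j == p).
have [->|lq] := eqVneq l q; first by rewrite jp.
have iq : i = q by apply/eqP; move: hq; rewrite (negbTE lq); case: (i == q).
by rewrite -jp -iq in pltq; lia.
Qed.

End Closed.

(** * The presentation [psi] and its monomial shadow [phi] *)

Section Fiber.
Variables (K : fieldType) (n : nat) (G : rel 'I_n).
Local Notation N := (2 * n + #|edges G|)%N.
Local Notation T := {mpoly K[(2 * n).+1]}.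
Local Notation R := {mpoly K[N]}.
Implicit Types (i j k l : 'I_n) (e : 'I_#|edges G|) (m : 'X_{1..N}).
Local Notation tau := (@tau_lt n).
Local Notation tauM := (tau_lt_monomial_order n).

(** The exponent of the tau-leading monomial of [psi_var v]. *)
Definition initial_exponent (v : 'I_N) : 'X_{1..(2 * n).+1} :=
  match split v with
  | inl a => U_(widen_ord (leqnSn (2 * n)) a)%MM
  | inr e => let p := enum_val e in (U_(xvar p.1) + U_(yvar p.2) + U_(tvar n))%MM
  end.

Definition phi m : 'X_{1..(2 * n).+1} := (\sum_(v < N) initial_exponent v *+ m v)%MM.

Lemma phiD m m' : phi (m + m') = (phi m + phi m')%MM.
Proof.
rewrite /phi -big_split; apply: eq_bigr => v _.
by apply/mnmP => u; rewrite /= !(mnmDE, mulmnE) mulnDr.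
Qed.

Lemma phiU v : phi U_(v) = initial_exponent v.
Proof.
rewrite /phi (bigD1 v) //= big1 => [|u uv]; rewrite mnm1E.
  by rewrite eqxx addm0 mulm1n.
by rewrite eq_sym (negbTE uv) mulm0n.
Qed.

Fact low_bound i : (i < 2 * n)%N.
Proof. by have := ltn_ord i; lia. Qed.

Fact high_bound i : (n + i < 2 * n)%N.
Proof. by have := ltn_ord i; lia. Qed.

Definition xm i : 'X_{1..N} := U_(lshift _ (Ordinal (low_bound i))).
Definition ym i : 'X_{1..N} := U_(lshift _ (Ordinal (high_bound i))).
Definition tm e : 'X_{1..N} := U_(rshift _ e).

Lemma widen_low i : widen_ord (leqnSn (2 * n)) (Ordinal (low_bound i)) = xvar i.
Proof. by apply: val_inj; rewrite /= xvarE. Qed.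

Lemma widen_high i : widen_ord (leqnSn (2 * n)) (Ordinal (high_bound i)) = yvar i.
Proof. by apply: val_inj; rewrite /= yvarE. Qed.

Lemma split_lshift (a : 'I_(2 * n)) : split (lshift #|edges G| a) = inl a.
Proof. exact: (unsplitK (inl a)). Qed.

Lemma split_rshift e : split (rshift (2 * n) e) = inr e.
Proof. exact: (unsplitK (inr e)). Qed.

Lemma phi_xm i : phi (xm i) = U_(xvar i)%MM.
Proof. by rewrite phiU /initial_exponent split_lshift widen_low. Qed.

Lemma phi_ym i : phi (ym i) = U_(yvar i)%MM.
Proof. by rewrite phiU /initial_exponent split_lshift widen_high. Qed.

Lemma phi_tm e i j : enum_val e = (i, j) ->
  phi (tm e) = (U_(xvar i) + U_(yvar j) + U_(tvar n))%MM.
Proof. by move=> he; rewrite phiU /initial_exponent split_rshift he. Qed.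

Lemma psiB (p q : R) : psi (p - q) = psi p - psi q.
Proof. exact: rmorphB. Qed.

Lemma psiD (p q : R) : psi (p + q) = psi p + psi q.
Proof. exact: rmorphD. Qed.

Lemma psiM (p q : R) : psi (p * q) = psi p * psi q.
Proof. exact: rmorphM. Qed.

Lemma psi1 : psi (1 : R) = 1.
Proof. exact: rmorph1. Qed.

Lemma psi0 : psi (0 : R) = 0.
Proof. exact: rmorph0. Qed.

Lemma psiZ c (p : R) : psi (c *: p) = c *: psi p.
Proof. exact: linearZ. Qed.

Lemma psi_sum (I : Type) (r : seq I) (P : pred I) (F : I -> R) :
  psi (\sum_(x <- r | P x) F x) = \sum_(x <- r | P x) psi (F x).
Proof. exact: rmorph_sum. Qed.

Lemma psiX m : psi ('X_[m] : R) = \prod_(v < N) psi_var K v ^+ m v.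
Proof. by rewrite /psi comp_mpolyX; apply: eq_bigr => v _; rewrite tnth_mktuple. Qed.

Lemma psiU v : psi ('X_[U_(v)] : R) = psi_var K v.
Proof.
rewrite psiX (bigD1 v) //= big1 => [|u uv]; rewrite mnm1E.
  by rewrite eqxx mulr1 expr1.
by rewrite eq_sym (negbTE uv) expr0.
Qed.

Lemma psi_xm i : psi ('X_[xm i] : R) = xx K i.
Proof. by rewrite psiU /psi_var split_lshift widen_low. Qed.

Lemma psi_ym i : psi ('X_[ym i] : R) = yy K i.
Proof. by rewrite psiU /psi_var split_lshift widen_high. Qed.

Lemma psi_tm e i j : enum_val e = (i, j) -> psi ('X_[tm e] : R) = fe K i j * tt K n.
Proof. by move=> he; rewrite psiU /psi_var split_rshift he. Qed.

Lemma enum_val_edge e i j : enum_val e = (i, j) -> (i, j) \in edges G.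
Proof. by move=> <-; exact: enum_valP. Qed.

Lemma edge_index i j : (i, j) \in edges G -> exists e, enum_val e = (i, j).
Proof. by move=> ij; exists (enum_rank_in ij (i, j)); rewrite enum_rankK_in. Qed.

(** Leading monomials multiply, so only single variables have to be checked, and there the tail of
    [f_e] is smaller by [tau_lt_exchange]. *)
Lemma monic_lead_psi m : monic_lead tau (psi ('X_[m] : R)) (phi m).
Proof.
rewrite psiX; apply: (big_rec2 (fun p a => monic_lead tau p a)).
  by rewrite -mpolyX0; exact: monic_leadX.
move=> v p a _ h; apply: (monic_leadM tauM) h.
suff hv : monic_lead tau (psi_var K v) (initial_exponent v).
  elim: (m v) => [|d ih]; first by rewrite mulm0n expr0 -mpolyX0; exact: monic_leadX.
  by rewrite mulmS exprS; exact: (monic_leadM tauM).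
rewrite /psi_var /initial_exponent; case: split => [b|e]; first exact: monic_leadX.
apply: (monic_leadM tauM); last exact: monic_leadX.
apply: monic_lead_fe; apply: tau_lt_exchange.
by have := enum_valP e; rewrite inE => /andP[].
Qed.

Lemma tdegD m m' : tdeg (m + m') = (tdeg m + tdeg m')%N.
Proof. by rewrite /tdeg -big_split; apply: eq_bigr => v _; rewrite mnmDE. Qed.

(** Each [t_e] contributes exactly one [t], so all monomials in a fibre of [phi] share their
    t-degree. *)
Lemma phi_tvar m : phi m (tvar n) = tdeg m.
Proof.
rewrite /phi mnm_sumE /tdeg [RHS]big_mkcond; apply: eq_bigr => v _.
rewrite mulmnE /initial_exponent; case: splitP => [a ->|e ->] /=.
  rewrite leqNgt ltn_ord mnm1E -val_eqE /=.
  by rewrite ltn_eqF ?ltn_ord.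
by rewrite leq_addr !mnmDE !mnm1E xvar_tvar yvar_tvar eqxx mul1n.
Qed.

Lemma tdeg_xm i : tdeg (xm i) = 0%N.
Proof. by rewrite -phi_tvar phi_xm mnm1E xvar_tvar. Qed.

Lemma tdeg_ym i : tdeg (ym i) = 0%N.
Proof. by rewrite -phi_tvar phi_ym mnm1E yvar_tvar. Qed.

Lemma tdeg_tm e : tdeg (tm e) = 1%N.
Proof.
case he : (enum_val e) => [i j].
by rewrite -phi_tvar (phi_tm he) !mnmDE !mnm1E xvar_tvar yvar_tvar eqxx.
Qed.

Lemma tdeg0_eq m : tdeg m = 0%N -> forall e, m (rshift _ e) = 0%N.
Proof.
move=> /eqP; rewrite sum_nat_eq0 => /forallP h e.
by have /implyP/(_ _)/eqP-> := h (rshift _ e); rewrite //= leq_addr.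
Qed.

Lemma phi_lshift m (a : 'I_(2 * n)) : tdeg m = 0%N ->
  phi m (widen_ord (leqnSn (2 * n)) a) = m (lshift _ a).
Proof.
move=> /tdeg0_eq m0; rewrite /phi mnm_sumE big_split_ord /= [X in (_ + X)%N]big1.
  rewrite addn0 (bigD1 a) //= big1 => [|b ba]; rewrite mulmnE /initial_exponent split_lshift mnm1E.
    by rewrite eqxx mul1n addn0.
  by rewrite -val_eqE /= val_eqE (negbTE ba).
by move=> e _; rewrite m0 mulm0n mnm0E.
Qed.

(** Without any [t_e], [phi] only renames variables. This is the base case of the connection of
    fibres. *)
Lemma phi_inj_tdeg0 m m' : tdeg m = 0%N -> phi m = phi m' -> m = m'.
Proof.
move=> m0 e; have m'0 : tdeg m' = 0%N by rewrite -phi_tvar -e phi_tvar.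
apply/mnmP => v; rewrite -(splitK v); case: (split v) => [a|f] /=.
  by rewrite -!phi_lshift // e.
by rewrite !tdeg0_eq.
Qed.

Lemma phi_var_gt0 m u : (0 < phi m u)%N ->
  exists2 v, (0 < m v)%N & (0 < initial_exponent v u)%N.
Proof.
move=> h; have /existsP[v /andP[]] : [exists v, (0 < m v)%N && (0 < initial_exponent v u)%N].
  apply: contraTT h => /existsPn h; rewrite -eqn0Ngt /phi mnm_sumE sum_nat_eq0.
  apply/forallP => v; apply/implyP => _; rewrite mulmnE muln_eq0 orbC.
  by have := h v; rewrite negb_and -!eqn0Ngt.
by exists v.
Qed.

End Fiber.

(** * Exchange relations on the fibres *)

Section Connect.
Variables (K : fieldType) (n : nat) (G : rel 'I_n).
Local Notation N := (2 * n + #|edges G|)%N.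
Local Notation R := {mpoly K[N]}.
Implicit Types (i j k l : 'I_n) (e a b : 'I_#|edges G|) (m : 'X_{1..N}).
Local Notation tau := (@tau_lt n).
Local Notation tauM := (tau_lt_monomial_order n).
Local Notation X := (@xm n G).
Local Notation Y := (@ym n G).
Local Notation E := (@tm n G).

Definition rel_ideal : R -> Prop :=
  ideal_gen (fun _ => True) (fun h => ker_psi h /\ exists d, (d <= 2)%N /\ thomog d h).

Lemma rel_ideal_ker (p : R) : rel_ideal p -> psi p = 0.
Proof.
elim/ideal_gen_ind => [|x y hx hy|c g _ [hg _]]; first exact: psi0.
  by rewrite psiD hx hy addr0.
by rewrite psiM hg mulr0.
Qed.

Lemma rel_idealM (p q : R) : rel_ideal q -> rel_ideal (p * q).
Proof. exact: ideal_genMl. Qed.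

Lemma rel_idealZ c (p : R) : rel_ideal p -> rel_ideal (c *: p).
Proof. by rewrite -mul_mpolyC; exact: rel_idealM. Qed.

Definition low mu (p : R) := forall m, m \in msupp p -> tau (phi m) mu.

Lemma low0 mu : low mu 0.
Proof. by move=> m; rewrite msupp0. Qed.

Lemma lowD mu p q : low mu p -> low mu q -> low mu (p + q).
Proof. by move=> hp hq m /msuppD_le; rewrite mem_cat => /orP[/hp|/hq]. Qed.

Lemma lowZ mu c p : low mu p -> low mu (c *: p).
Proof. by move=> hp m /msuppZ_le /hp. Qed.

Lemma lowX mu m : tau (phi m) mu -> low mu 'X_[m].
Proof. by move=> h m'; rewrite msuppX inE => /eqP->. Qed.

Lemma lowMX mu m p : low mu p -> low (mu + phi m) (p * 'X_[m]).
Proof.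
move=> hp m'; rewrite (perm_mem (msuppMX _ _)) => /mapP[u /hp h ->].
by rewrite phiD addmC (mo_add tauM).
Qed.

Lemma thomogD d (p q : R) : thomog d p -> thomog d q -> thomog d (p + q).
Proof. by move=> hp hq m /msuppD_le; rewrite mem_cat => /orP[/hp|/hq]. Qed.

Lemma thomogZ d c (p : R) : thomog d p -> thomog d (c *: p).
Proof. by move=> hp m /msuppZ_le /hp. Qed.

Lemma thomogX d m : tdeg m = d -> thomog d ('X_[m] : R).
Proof. by move=> h m'; rewrite msuppX inE => /eqP->. Qed.

(** The lower part [q] is left unspecified; it is removed later by well-founded induction along
    tau. *)
Definition sim m m' := phi m = phi m' /\
  exists p q, [/\ rel_ideal p, low (phi m) q & 'X_[m] - 'X_[m'] = p + q].

Lemma sim_refl m : sim m m.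
Proof.
by split=> //; exists 0, 0; rewrite subrr addr0; split=> //; [exact: ideal_gen0 | exact: low0].
Qed.

Lemma sim_sym m m' : sim m m' -> sim m' m.
Proof.
move=> [e [p [q [hp hq h]]]]; split=> //; exists (-1 *: p), (-1 *: q); split.
- exact: rel_idealZ.
- by rewrite -e; exact: lowZ.
- by rewrite -scalerDr -h scaleN1r opprB.
Qed.

Lemma sim_trans m2 m1 m3 : sim m1 m2 -> sim m2 m3 -> sim m1 m3.
Proof.
move=> [e [p [q [hp hq h]]]] [e' [p' [q' [hp' hq' h']]]]; split; first by rewrite e.
exists (p + p'), (q + q'); split; first exact: ideal_genD.
  by apply: lowD => //; rewrite e.
by rewrite addrACA -h -h' addrA subrK.
Qed.

Lemma sim_add m m1 m2 : sim m1 m2 -> sim (m1 + m) (m2 + m).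
Proof.
move=> [e [p [q [hp hq h]]]]; split; first by rewrite !phiD e.
exists ('X_[m] * p), (q * 'X_[m]); split; first exact: rel_idealM.
  by rewrite phiD; exact: lowMX.
by rewrite ['X_[m] * p]mulrC -mulrDl -h mulrBl !mpolyXD.
Qed.

(** The binomial minus its tail [h] is killed by [psi] and t-homogeneous of degree at most 2, hence
    one of the generators of [rel_ideal]. Equality of [phi] gives [m'] the same t-degree as [m]. *)
Lemma sim_intro m m' (h : R) d : (d <= 2)%N -> tdeg m = d -> phi m = phi m' ->
  low (phi m) h -> thomog d h -> psi ('X_[m] : R) - psi ('X_[m'] : R) = psi h -> sim m m'.
Proof.
move=> d2 md e lh th ph; split=> //; exists (1 * ('X_[m] - 'X_[m'] + -1 *: h)), h.
split=> //; last by rewrite scaleN1r mul1r subrK.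
apply: mem_ideal_gen => //; split.
  by rewrite /ker_psi psiD psiB ph psiZ scaleN1r subrr.
exists d; split=> //; apply: thomogD; last exact: thomogZ.
rewrite -[- _]scaleN1r.
by apply: thomogD; [|apply: thomogZ]; apply: thomogX => //; rewrite -phi_tvar -e phi_tvar.
Qed.

Ltac mnm_ring := apply/mnmP => ?; rewrite !mnmDE; lia.

Lemma tau_exchange_add i j mu nu rho : (i < j)%N ->
  mu = (U_(xvar j) + U_(yvar i) + rho)%MM -> nu = (U_(xvar i) + U_(yvar j) + rho)%MM ->
  tau mu nu.
Proof. by move=> ij -> ->; rewrite (mo_add tauM); exact: tau_lt_exchange. Qed.

(** The linear relation [x_k t_ij - x_i t_kj = x_j t_ik]; the edge [(i, k)] exists by closedness,
    and the tail is smaller because [k < j]. *)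
Lemma sim_exchange_x i j k a b :
  @closed_graph K n G -> (i < k)%N -> enum_val a = (i, j) -> enum_val b = (k, j) ->
  sim (X k + E a) (X i + E b).
Proof.
move=> cl ik ha hb; have ij := enum_val_edge ha; have kj := enum_val_edge hb.
have [c hc] := edge_index (closed_edge_lower cl ik ij kj).
have kltj : (k < j)%N by move: kj; rewrite mem_edges => /andP[].
apply: (@sim_intro _ _ 'X_[X j + E c] 1) => //.
- by rewrite tdegD tdeg_xm tdeg_tm.
- by rewrite !phiD !phi_xm (phi_tm ha) (phi_tm hb); mnm_ring.
- apply: lowX; rewrite !phiD !phi_xm (phi_tm ha) (phi_tm hc).
  by apply: (@tau_exchange_add k j _ _ (U_(xvar i) + U_(tvar n))%MM) => //; mnm_ring.
- by apply: thomogX; rewrite tdegD tdeg_xm tdeg_tm.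
- by rewrite !mpolyXD !psiM !psi_xm (psi_tm _ ha) (psi_tm _ hb) (psi_tm _ hc) /fe; ring.
Qed.

(** The linear relation [y_l t_ij - y_j t_il = - y_i t_jl]; the edge [(j, l)] exists by closedness,
    and the tail is smaller because [i < j]. *)
Lemma sim_exchange_y i j l a b :
  @closed_graph K n G -> (j < l)%N -> enum_val a = (i, j) -> enum_val b = (i, l) ->
  sim (Y l + E a) (Y j + E b).
Proof.
move=> cl jl ha hb; have ij := enum_val_edge ha; have il := enum_val_edge hb.
have [c hc] := edge_index (closed_edge_upper cl jl ij il).
have iltj : (i < j)%N by move: ij; rewrite mem_edges => /andP[].
apply: (@sim_intro _ _ (-1 *: 'X_[Y i + E c]) 1) => //.
- by rewrite tdegD tdeg_ym tdeg_tm.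
- by rewrite !phiD !phi_ym (phi_tm ha) (phi_tm hb); mnm_ring.
- apply: lowZ; apply: lowX; rewrite !phiD !phi_ym (phi_tm ha) (phi_tm hc).
  by apply: (@tau_exchange_add i j _ _ (U_(yvar l) + U_(tvar n))%MM) => //; mnm_ring.
- by apply: thomogZ; apply: thomogX; rewrite tdegD tdeg_ym tdeg_tm.
- rewrite psiZ scaleN1r !mpolyXD !psiM !psi_ym.
  by rewrite (psi_tm _ ha) (psi_tm _ hb) (psi_tm _ hc) /fe; ring.
Qed.

(** The Koszul relation [f_kl t_ij = f_ij t_kl], with the leading terms of both sides collected on
    the left and the two tails on the right. *)
Lemma sim_koszul i j k l a b : enum_val a = (i, j) -> enum_val b = (k, l) ->
  sim (X k + Y l + E a) (X i + Y j + E b).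
Proof.
move=> ha hb.
have iltj : (i < j)%N by have := enum_val_edge ha; rewrite mem_edges => /andP[].
have kltl : (k < l)%N by have := enum_val_edge hb; rewrite mem_edges => /andP[].
apply: (@sim_intro _ _ ('X_[X l + Y k + E a] + -1 *: 'X_[X j + Y i + E b]) 1) => //.
- by rewrite !tdegD tdeg_xm tdeg_ym tdeg_tm.
- by rewrite !phiD !phi_xm !phi_ym (phi_tm ha) (phi_tm hb); mnm_ring.
- apply: lowD; [|apply: lowZ]; apply: lowX;
    rewrite !phiD !phi_xm !phi_ym (phi_tm ha) ?(phi_tm hb).
    apply: (@tau_exchange_add k l _ _ (phi (E a))) => //; rewrite (phi_tm ha); mnm_ring.
  by apply: (@tau_exchange_add i j _ _ (phi (E b))) => //; rewrite (phi_tm hb); mnm_ring.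
- by apply: thomogD; [|apply: thomogZ]; apply: thomogX; rewrite !tdegD tdeg_xm tdeg_ym tdeg_tm.
- rewrite psiD psiZ scaleN1r !mpolyXD !psiM !psi_xm !psi_ym.
  by rewrite (psi_tm _ ha) (psi_tm _ hb) /fe; ring.
Qed.

(* [f_kj f_il - f_ij f_kl = - f_ki f_lj], a Plücker relation whose right-hand side
   has a smaller leading monomial. *)
Lemma sim_plucker k i l j a b : @closed_graph K n G -> (k < i)%N -> (i < l)%N -> (l < j)%N ->
  enum_val a = (k, j) -> enum_val b = (i, l) ->
  forall c, enum_val c = (i, j) -> exists d, sim (E a + E b) (E c + E d).
Proof.
move=> cl ki il lj ha hb c hc.
have kj_edge := enum_val_edge ha; have il_edge := enum_val_edge hb.
have ij_edge := enum_val_edge hc.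
(* The edges [(i, l)] and [(i, j)] share their lower end and give [(l, j)]; [(k, j)] and [(i, j)]
   share their upper end and give [(k, i)]; then [(k, j)] and [(l, j)] give [(k, l)]. *)
have lj_edge := closed_edge_upper cl lj il_edge ij_edge.
have ki_edge := closed_edge_lower cl ki kj_edge ij_edge.
have kl_edge := closed_edge_lower cl (ltn_trans ki il) kj_edge lj_edge.
have [d hd] := edge_index kl_edge; have [f hf] := edge_index ki_edge.
have [g hg] := edge_index lj_edge; exists d.
apply: (@sim_intro _ _ (-1 *: 'X_[E f + E g]) 2) => //.
- by rewrite tdegD !tdeg_tm.
- by rewrite !phiD (phi_tm ha) (phi_tm hb) (phi_tm hc) (phi_tm hd); mnm_ring.
- apply: lowZ; apply: lowX; rewrite !phiD (phi_tm ha) (phi_tm hb) (phi_tm hf) (phi_tm hg).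
  pose rho := (U_(xvar k) + U_(yvar j) + U_(tvar n) + U_(tvar n))%MM.
  by apply: (@tau_exchange_add i l _ _ rho) => //; rewrite /rho; mnm_ring.
- by apply: thomogZ; apply: thomogX; rewrite tdegD !tdeg_tm.
- rewrite psiZ scaleN1r !mpolyXD !psiM (psi_tm _ ha) (psi_tm _ hb) (psi_tm _ hc).
  by rewrite (psi_tm _ hd) (psi_tm _ hf) (psi_tm _ hg) /fe; ring.
Qed.

Lemma mnm_split m v : (0 < m v)%N -> exists m1, m = (U_(v) + m1)%MM.
Proof.
move=> h; exists (m - U_(v))%MM; rewrite addmC submK //.
by apply/mnm_lepP => u; rewrite mnm1E; case: eqP => // <-.
Qed.

Lemma mnm_split2 m u v : u != v -> (0 < m u)%N -> (0 < m v)%N ->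
  exists m1, m = (U_(u) + U_(v) + m1)%MM.
Proof.
move=> uv mu mv; have [m1 e] := mnm_split mu; move: mv.
rewrite e mnmDE mnm1E (negbTE uv) => /mnm_split[m2 ->].
by exists m2; rewrite addmA.
Qed.

Lemma mnm_split3 m u v w : u != v -> u != w -> v != w ->
  (0 < m u)%N -> (0 < m v)%N -> (0 < m w)%N ->
  exists m1, m = (U_(u) + U_(v) + U_(w) + m1)%MM.
Proof.
move=> uv uw vw mu mv mw; have [m1 e] := mnm_split2 uv mu mv; move: mw.
rewrite e !mnmDE !mnm1E (negbTE uw) (negbTE vw) => /mnm_split[m2 ->].
by exists m2; rewrite addmA.
Qed.

Local Notation rx i := (lshift #|edges G| (Ordinal (low_bound i))).
Local Notation ry i := (lshift #|edges G| (Ordinal (high_bound i))).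
Local Notation re e := (rshift (2 * n) e).

Lemma phi_xvar_gt0 m i : (0 < phi m (xvar i))%N ->
  (0 < m (rx i))%N \/ exists b j, enum_val b = (i, j) /\ (0 < m (re b))%N.
Proof.
case/phi_var_gt0 => v; rewrite -(splitK v); case: (split v) => [c|b] /=.
  rewrite /initial_exponent split_lshift mnm1E => mv; case: eqP => // e _; left.
  suff <- : c = Ordinal (low_bound i) by [].
  by apply: val_inj; move/(congr1 val): e; rewrite /= xvarE.
rewrite /initial_exponent split_rshift; case hb : (enum_val b) => [p q] mb.
rewrite !mnmDE !mnm1E xvar_inj [yvar _ == _]eq_sym xvar_yvar [tvar n == _]eq_sym.
rewrite xvar_tvar !addn0 lt0b /= => /eqP pi; right; exists b, q.
by rewrite hb pi.
Qed.

Lemma phi_yvar_gt0 m j : (0 < phi m (yvar j))%N ->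
  (0 < m (ry j))%N \/ exists b i, enum_val b = (i, j) /\ (0 < m (re b))%N.
Proof.
case/phi_var_gt0 => v; rewrite -(splitK v); case: (split v) => [c|b] /=.
  rewrite /initial_exponent split_lshift mnm1E => mv; case: eqP => // e _; left.
  suff <- : c = Ordinal (high_bound j) by [].
  by apply: val_inj; move/(congr1 val): e; rewrite /= yvarE.
rewrite /initial_exponent split_rshift; case hb : (enum_val b) => [p q] mb.
rewrite !mnmDE !mnm1E xvar_yvar yvar_inj [tvar n == _]eq_sym yvar_tvar.
rewrite addn0 lt0b /= => /eqP qj; right; exists b, p.
by rewrite hb qj.
Qed.

Lemma phi_tvar_gt0 m : (0 < tdeg m)%N -> exists b, (0 < m (re b))%N.
Proof.
rewrite lt0n => h; apply/existsP; apply: contraNT h => /existsPn h.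
rewrite sum_nat_eq0; apply/forallP => v; apply/implyP.
rewrite -(splitK v); case: (split v) => [c|b] /= hv; first by rewrite leqNgt ltn_ord in hv.
by rewrite -leqn0 leqNgt h.
Qed.

(** Since [x_i y_j t] divides [phi m'], each of [x_i] and [y_j] comes from a variable of [m'] or
    from some [t_b] in it. This makes four cases, each settled by one exchange; maximality of
    [(i, j)] orders the endpoints as that exchange requires. *)
Lemma sim_contains m m' a i j : @closed_graph K n G -> enum_val a = (i, j) ->
  phi m = phi m' -> (0 < m (re a))%N ->
  (forall b k l, enum_val b = (k, l) -> (0 < m' (re b))%N -> (l < j)%N || (l == j) && (k <= i)%N) ->
  exists m1, sim m' (E a + m1).
Proof.
move=> cl ha e ma amax; case: (ltnP 0 (m' (re a))) => [/mnm_split[m1 ->]|m'a].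
  by exists m1; exact: sim_refl.
have [m0 em] := mnm_split ma.
have hy : (0 < phi m' (yvar j))%N.
  by rewrite -e em phiD mnmDE -/(tm a) (phi_tm ha) !mnmDE !mnm1E eqxx; lia.
have hx : (0 < phi m' (xvar i))%N.
  by rewrite -e em phiD mnmDE -/(tm a) (phi_tm ha) !mnmDE !mnm1E eqxx; lia.
have ht : (0 < tdeg m')%N.
  by rewrite -phi_tvar -e em phiD mnmDE !phi_tvar -/(tm a) tdeg_tm.
have nlr (c : 'I_(2 * n)) b : lshift #|edges G| c != re b.
  by rewrite -val_eqE /=; have := ltn_ord c; lia.
have nxy k l : rx k != ry l by rewrite -val_eqE /=; have := ltn_ord k; lia.
case: (phi_xvar_gt0 hx) (phi_yvar_gt0 hy) => [mx|[b [l [hb mb]]]] [my|[c [k [hc mc]]]].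
(* Both [x_i] and [y_j] are variables of [m']: a Koszul exchange with any [t_b] in [m'], which
   exists as the t-degree is positive. *)
- have [b mb] := phi_tvar_gt0 ht; case hb : (enum_val b) => [p q].
  have [m1 ->] := mnm_split3 (nxy i j) (nlr _ b) (nlr _ b) mx my mb.
  exists (X p + Y q + m1)%MM.
  have -> : (E a + (X p + Y q + m1) = X p + Y q + E a + m1)%MM by mnm_ring.
  by apply: sim_add; exact: sim_koszul.
(* The variable [x_i] and some [t_(k,j)]: maximality gives [k <= i], and [k = i] would put [t_a] in
   [m']. *)
- have ki : (k < i)%N.
    have := amax _ _ _ hc mc; rewrite eqxx ltnn /= leq_eqVlt => /orP[/eqP/val_inj ki|//].
    suff ca : c = a by rewrite ca ltnNge m'a in mc.
    by apply: enum_val_inj; rewrite hc ha ki.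
  have [m1 ->] := mnm_split2 (nlr _ c) mx mc; exists (X k + m1)%MM.
  have -> : (E a + (X k + m1) = X k + E a + m1)%MM by mnm_ring.
  by apply: sim_add; exact: sim_exchange_x cl ki hc ha.
(* The variable [y_j] and some [t_(i,l)]: maximality gives [l <= j], and [l = j] would put [t_a] in
   [m']. *)
- have lj : (l < j)%N.
    have := amax _ _ _ hb mb; case/orP => // /andP[/eqP lj _].
    suff ca : b = a by rewrite ca ltnNge m'a in mb.
    by apply: enum_val_inj; rewrite hb ha lj.
  have [m1 ->] := mnm_split2 (nlr _ b) my mb; exists (Y l + m1)%MM.
  have -> : (E a + (Y l + m1) = Y l + E a + m1)%MM by mnm_ring.
  by apply: sim_add; exact: sim_exchange_y cl lj hb ha.
(* Both come from edges [(k, j)] and [(i, l)]: as above [k < i] and [l < j], and [i < l] because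
   [(i, l)] is an edge, so the Plücker exchange applies. *)
have ki : (k < i)%N.
  have := amax _ _ _ hc mc; rewrite eqxx ltnn /= leq_eqVlt => /orP[/eqP/val_inj ki|//].
  suff ca : c = a by rewrite ca ltnNge m'a in mc.
  by apply: enum_val_inj; rewrite hc ha ki.
have lj : (l < j)%N.
  have := amax _ _ _ hb mb; case/orP => // /andP[/eqP lj _].
  suff ca : b = a by rewrite ca ltnNge m'a in mb.
  by apply: enum_val_inj; rewrite hb ha lj.
have il : (i < l)%N by have := enum_val_edge hb; rewrite mem_edges => /andP[].
have cb : re c != re b.
  rewrite (inj_eq (@rshift_inj _ _)); apply/eqP => cb.
  by move: hc; rewrite cb hb => -[ik _]; rewrite ik ltnn in ki.
have [m1 ->] := mnm_split2 cb mc mb.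
have [d hd] := sim_plucker cl ki il lj hc hb ha; exists (E d + m1)%MM.
by rewrite addmA; exact: sim_add.
Qed.

(** Induction on the t-degree: once both monomials contain a common [t_a], cancelling it keeps the
    values of [phi] equal and lowers the degree by one. *)
Lemma phi_eq_sim m m' : @closed_graph K n G -> phi m = phi m' -> sim m m'.
Proof.
move=> cl; move: {2}(tdeg m) (erefl (tdeg m)) => d.
elim: d m m' => [|d ih] m m' md e.
  by rewrite (phi_inj_tdeg0 md e); exact: sim_refl.
(* As the first endpoint is less than [n], this number orders edges by second endpoint, then by
   first. *)
pose key b := ((enum_val b).2 * n + (enum_val b).1)%N.
have main a m1 m2 : tdeg m1 = d.+1 -> phi m1 = phi m2 -> (0 < m1 (re a))%N ->
    (forall b, (0 < m2 (re b))%N -> (key b <= key a)%N) -> sim m1 m2.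
  move=> m1d e12 m1a amax; case ha : (enum_val a) => [i j].
  have [|u hu] := @sim_contains m1 m2 a i j cl ha e12 m1a.
    move=> b k l hb mb; have := amax b mb; rewrite /key ha hb /= -(inj_eq val_inj) /=.
    by have := ltn_ord k; have := ltn_ord i; nia.
  have [u1 eu] := mnm_split m1a; apply: sim_trans (sim_sym hu).
  have eE : phi u1 = phi u.
    have := proj1 hu; rewrite -e12 eu !phiD -/(tm a) => /mnmP h; apply/mnmP => v.
    by have := h v; rewrite !mnmDE; lia.
  rewrite eu ![(_ + u1)%MM]addmC [(E a + u)%MM]addmC; apply: sim_add; apply: ih => //.
  by move: m1d; rewrite eu tdegD -/(tm a) tdeg_tm; lia.
(* The maximum runs over the edges of both monomials; whichever contains it plays the role of [m1],
   and symmetry of [sim] covers the other case. *)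
pose P b := (0 < m (re b))%N || (0 < m' (re b))%N.
have [a0 ha0] : exists b, P b.
  by have [|b mb] := @phi_tvar_gt0 m; [rewrite md | exists b; rewrite /P mb].
case: (arg_maxnP (P := P) key ha0) => a /orP[ma|m'a] amax.
  by apply: (main a) => // b mb; apply: amax; rewrite /P mb orbT.
apply: sim_sym; apply: (main a) => //; first by rewrite -phi_tvar -e phi_tvar.
by move=> b mb; apply: amax; rewrite /P mb.
Qed.

End Connect.

(** * Standard representatives *)

Section Standard.
Variables (K : fieldType) (n : nat) (G : rel 'I_n).
Local Notation N := (2 * n + #|edges G|)%N.
Local Notation T := {mpoly K[(2 * n).+1]}.
Local Notation R := {mpoly K[N]}.
Implicit Types (g : R) (m : 'X_{1..N}).
Local Notation tau := (@tau_lt n).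
Local Notation tauM := (tau_lt_monomial_order n).

(** The default [m] lies in its own fibre, so [choose] returns a member of the fibre, and one that
    depends on the fibre alone. *)
Definition std m : 'X_{1..N} := choose (fun m' => phi m' == phi m) m.

Lemma phi_std m : phi (std m) = phi m.
Proof. by apply/eqP; apply: (@chooseP _ (fun m' => phi m' == phi m)). Qed.

Lemma std_eq m m' : phi m = phi m' -> std m = std m'.
Proof.
move=> e; rewrite /std (@eq_choose _ _ (fun u => phi u == phi m')) => [|u]; last by rewrite e.
by apply: choose_id; rewrite ?e.
Qed.

Definition standard g := forall m, m \in msupp g -> std m = m.

Lemma standardD g g' : standard g -> standard g' -> standard (g + g').
Proof. by move=> h h' m /msuppD_le; rewrite mem_cat => /orP[/h|/h']. Qed.

Definition reducible g := exists2 g', standard g' & rel_ideal (g - g').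

Lemma reducibleD g h : reducible g -> reducible h -> reducible (g + h).
Proof.
move=> [g' sg rg] [h' sh rh]; exists (g' + h'); first exact: standardD.
by rewrite opprD addrACA; exact: ideal_genD.
Qed.

Lemma reducibleZ c g : reducible g -> reducible (c *: g).
Proof.
move=> [g' sg rg]; exists (c *: g'); first by move=> m /msuppZ_le /sg.
by rewrite -scalerBr; exact: rel_idealZ.
Qed.

Lemma reducible0 : reducible 0.
Proof.
by exists 0; [move=> m; rewrite msupp0 | rewrite subrr; exact: ideal_gen0].
Qed.

Lemma reducible_of_msupp g : (forall m, m \in msupp g -> reducible 'X_[m]) -> reducible g.
Proof.
move=> h; rewrite (mpolyE g) big_seq; apply: big_ind => [||m mg].
- exact: reducible0.
- exact: reducibleD.
- by apply: reducibleZ; exact: h.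
Qed.

(** Well-founded induction on [phi m]: [m] equals its representative plus a relation plus terms of
    smaller [phi], which are reducible by induction. *)
Lemma closed_reducible g : @closed_graph K n G -> reducible g.
Proof.
move=> cl; apply: reducible_of_msupp => m _.
move: {2}(phi m) (erefl (phi m)) => mu.
elim/(well_founded_ind (@tau_lt_wf n)): mu m => mu IH m em.
have [_ [p [q [hp hq e]]]] := phi_eq_sim cl (esym (phi_std m)).
have -> : 'X_[m] = 'X_[std m] + p + q by rewrite -addrA -e addrC subrK.
apply: reducibleD; last first.
  by apply: reducible_of_msupp => u /hq; rewrite em => /IH; apply.
exists 'X_[std m]; last by rewrite addrAC subrr add0r.
by move=> u; rewrite msuppX inE => /eqP->; apply: std_eq; exact: phi_std.
Qed.

Lemma phi_max (s : seq 'X_{1..N}) : s != [::] ->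
  exists2 m, m \in s & forall u, u \in s -> phi u != phi m -> tau (phi u) (phi m).
Proof.
elim: s => // a s ih _; have [->|/ih[m ms mmax]] := eqVneq s [::].
  by exists a => [|u]; rewrite inE // => /eqP->; rewrite eqxx.
have [am|am] := boolP (tau (phi m) (phi a)).
  exists a => [|u]; rewrite inE ?eqxx // => /predU1P[->|/mmax us _]; first by rewrite eqxx.
  by have [->//|/us um] := eqVneq (phi u) (phi m); exact: (mo_trans tauM um am).
exists m => [|u]; rewrite inE ?ms ?orbT // => /predU1P[->|/mmax//].
by move=> /(mo_total tauM); rewrite (negbTE am) orbF.
Qed.

(** Take [m] in the support with [phi m] maximal; no other monomial of the support shares its [phi],
    so the leading term cannot cancel. *)
Lemma standard_init g : standard g -> g != 0 ->
  exists m, psi g != 0 /\ init tau (psi g) = 'X_[phi m].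
Proof.
move=> sg g0; have [|m mg mmax] := @phi_max (msupp g); first by rewrite msupp_eq0.
exists m; apply: (init_below tauM (c := g@_m)); first by rewrite -mcoeff_msupp.
have -> : psi g - g@_m *: 'X_[phi m] =
    g@_m *: (psi ('X_[m] : R) - 'X_[phi m])
    + \sum_(u <- msupp g | u != m) g@_u *: psi ('X_[u] : R).
  rewrite {1}(mpolyE g) psi_sum (bigD1_seq m) ?msupp_uniq //= psiZ scalerBr addrAC.
  by congr (_ - _ + _); apply: eq_bigr => u _; rewrite psiZ.
apply: belowD; first by apply: belowZ; exact: monic_lead_psi.
rewrite big_seq_cond; apply: below_sum => u /andP[ug um]; apply: belowZ.
have lum : tau (phi u) (phi m).
  (* If [phi u = phi m], then [u = std u = std m = m]. *)
  by apply: mmax => //; apply: contraNneq um => /std_eq; rewrite !sg // => ->.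
rewrite -[psi _](subrK 'X_[phi u]); apply: belowD; last exact: belowX.
exact: (below_trans tauM lum) (@monic_lead_psi _ _ _ _).
Qed.

(** * Relation type, Sagbi basis and initial algebra *)

Lemma closed_reltype : @closed_graph K n G -> @reltype_le K n G 2.
Proof.
move=> cl g kg; have [g' sg hg] := closed_reducible g cl.
(* The standard form [g'] is again in the kernel, whereas a nonzero standard polynomial has nonzero
   image. *)
suff g'0 : g' = 0 by move: hg; rewrite g'0 subr0.
apply/eqP; apply: contraT => /(standard_init sg)[m [/negP[]]].
by have := rel_ideal_ker hg; rewrite psiB kg sub0r => /eqP; rewrite oppr_eq0.
Qed.

Lemma sagbiBE (b : T) : sagbiB G b <-> rees_gen (@BEgens K n G) b.
Proof.
split; case=> [h|]; try by left.
  by move=> [e [eG ->]]; right; exists (fe K e.1 e.2); split=> //; exists e.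
by move=> [f [[e [eG ->]] ->]]; right; exists e.
Qed.

Lemma Rees_JG : set_eq (Rees (@JG K n G)) (alg_gen (@sagbiB K n G)).
Proof.
move=> p; split=> [/Rees_SIdeal|h].
  by apply: alg_gen_sub => g /sagbiBE; exact: mem_alg_gen.
by apply/Rees_SIdeal; apply: alg_gen_sub h => g /sagbiBE; exact: mem_alg_gen.
Qed.

Lemma Rees_psi f : Rees (@JG K n G) f -> exists g : R, psi g = f.
Proof.
move/Rees_JG; elim/alg_gen_ind => {f} [|f f' [g <-] [g' <-]|c f [g <-]|b f hb [g <-]].
- by exists 1; exact: psi1.
- by exists (g + g'); rewrite psiD.
- by exists (c *: g); rewrite psiZ.
case: hb => [[i [->|->]]|[[i j] [/edge_index[e he] ->]]].
- by exists ('X_[xm G i] * g); rewrite psiM psi_xm.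
- by exists ('X_[ym G i] * g); rewrite psiM psi_ym.
- by exists ('X_[tm e] * g); rewrite psiM (psi_tm _ he).
Qed.

Lemma psi_var_sagbiB (v : 'I_N) : sagbiB G (psi_var K v).
Proof.
rewrite /psi_var; case: splitP => [a _|e _]; last first.
  by right; exists (enum_val e); split=> //; exact: enum_valP.
have : (widen_ord (leqnSn (2 * n)%N) a < 2 * n)%N by exact: (ltn_ord a).
case: (varP (widen_ord _ a)) => [i _|i _|]; last by rewrite ltnn.
  by left; exists i; left.
by left; exists i; right.
Qed.

Local Notation initial_gen := (fun g : T => exists b, sagbiB G b /\ g = init tau b).

(** [phi m] is a sum of exponents [initial_exponent v], and each of these belongs to the initial
    monomial of the generator [psi_var K v]. *)
Lemma initial_monomial m : alg_gen initial_gen ('X_[phi m] : T).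
Proof.
rewrite (big_morph (fun u : 'X_{1..(2 * n).+1} => 'X_[u] : T) (@mpolyXD _ _) (@mpolyX0 _ _)).
apply: alg_gen_prod => v _; rewrite -mpolyXn; apply: alg_genX; apply: mem_alg_gen.
exists (psi_var K v); split; first exact: psi_var_sagbiB.
by rewrite -psiU -phiU (init_monic tauM (@monic_lead_psi _ _ _ _)).
Qed.

Lemma closed_sagbi : @closed_graph K n G -> sagbi tau (Rees (@JG K n G)) (@sagbiB K n G).
Proof.
move=> cl; have sub (b : T) : sagbiB G b -> Rees (JG G) b.
  by move=> hb; apply/Rees_JG; exact: mem_alg_gen.
split=> // p; split; apply: alg_gen_sub => _ [f [hf ->]].
  by apply: mem_alg_gen; exists f; split=> //; exact: sub.
(* An element of the Rees algebra is lifted along [psi], and the lift is replaced by a standard one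
   with the same image. *)
have [g <-] := Rees_psi hf; have [g' sg hg] := closed_reducible g cl.
have -> : psi g = psi g'.
  by apply/eqP; rewrite -subr_eq0 -psiB; apply/eqP; exact: rel_ideal_ker.
have [->|/(standard_init sg)[m [_ ->]]] := eqVneq g' 0; last exact: initial_monomial.
by rewrite psi0 /init eqxx; exact: alg_gen0.
Qed.

(** Initial forms are compatible with the factor [t]: the tau-initial form of [f_e t] is the
    sigma-initial form of [f_e] times [t]. *)
Lemma rees_gen_init (g : T) :
  rees_gen (fun h => exists f, BEgens G f /\ h = init (@sigma_lt n) f) g <-> initial_gen g.
Proof.
have initX v : init tau ('X_v : T) = 'X_v by rewrite (init_monic tauM (@monic_leadX _ _ _ _)).
have init_fet i j : (i, j) \in edges G ->
    init tau (fe K i j * tt K n) = init (@sigma_lt n) (fe K i j) * tt K n.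
  rewrite mem_edges => /andP[ij _]; rewrite init_fe // -mpolyXD.
  apply: (init_monic tauM); apply: (monic_leadM tauM); last exact: monic_leadX.
  by apply: monic_lead_fe; exact: tau_lt_exchange.
split.
  case=> [[i hi]|[_ [[_ [[[i j] [ij ->]] ->]] ->]]].
    exists g; split; first by left; exists i.
    by case: hi => ->; rewrite initX.
  exists (fe K i j * tt K n); split; last by rewrite init_fet.
  by right; exists (i, j).
case=> b [hb ->]; case: hb => [[i hi]|[[i j] [ij ->]]].
  by left; exists i; case: hi => ->; rewrite initX; [left|right].
right; exists (init (@sigma_lt n) (fe K i j)); split; last exact: init_fet.
by exists (fe K i j); split=> //; exists (i, j).
Qed.

(** Closedness identifies the initial ideal with the one generated by the initial forms of the
    [f_e]. The algebra generators of its Rees algebra are then the initial forms of the Sagbi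
    basis. *)
Lemma closed_initial_algebra : @closed_graph K n G ->
  set_eq (initial_algebra tau (Rees (@JG K n G)))
         (Rees (initial_ideal (@sigma_lt n) (@JG K n G))).
Proof.
move=> cl p; have [_ /(_ p) [h1 h2]] := closed_sagbi cl.
split.
  move/h2 => h; apply: (@Rees_sub _ _ _ _ _ (fun q => proj2 (cl q))).
  by apply/Rees_SIdeal; apply: alg_gen_sub h => g /rees_gen_init; exact: mem_alg_gen.
move/(@Rees_sub _ _ _ _ _ (fun q => proj1 (cl q)))/Rees_SIdeal => h; apply: h1.
by apply: alg_gen_sub h => g /rees_gen_init; exact: mem_alg_gen.
Qed.

End Standard.

Theorem mainTheorem5 (K : fieldType) (n : nat) (G : rel 'I_n)
  (Gsym : forall i j, G i j = G j i) (Girr : irreflexive G)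
  (Hclosed : @closed_graph K n G) :
  set_eq (@initial_algebra K n (@tau_lt n) (@Rees K n (@JG K n G)))
         (@Rees K n (@initial_ideal K n (@sigma_lt n) (@JG K n G)))
  /\ @reltype_le K n G 2
  /\ @sagbi K n (@tau_lt n) (@Rees K n (@JG K n G)) (@sagbiB K n G).
Proof.
split; first exact: closed_initial_algebra.
by split; [exact: closed_reltype | exact: closed_sagbi].
Qed.
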